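(* For any graph $G$, $\mathrm{fun}(G)\le 2\,\mathrm{cwd}(G)-1$.
   Context: All graphs are finite, simple (undirected, no loops, no multiple edges), with nonempty vertex set. For a graph $G=(V,E)$ let $A(x,y)=1$ if $x,y\in V$ are adjacent and $A(x,y)=0$ otherwise. Functionality: a vertex $y\in V$ is a function of vertices $x_1,\dots,x_k\in V\setminus\{y\}$ if there exists a Boolean function $f:\{0,1\}^k\to\{0,1\}$ such that for every $z\in V\setminus\{y,x_1,\dots,x_k\}$, $A(y,z)=f(A(x_1,z),\dots,A(x_k,z))$. The functionality $\mathrm{fun}(y)$ of $y$ (in $G$) is the minimum $k\ge 0$ such that $y$ is a function of some $k$ vertices. The functionality of the graph is $\mathrm{fun}(G)=\max_H\min_{y\in V(H)}\mathrm{fun}(y)$, where the maximum is over all (nonempty) induced subgraphs $H$ of $G$ and $\mathrm{fun}(y)$ is computed in $H$. Clique-width: $\mathrm{cwd}(G)$ is the minimum number of labels needed to construct $G$ by means of the following four operations on vertex-labelled graphs: creation of a single new vertex with label $i$; disjoint union of two labelled graphs; adding all edges between vertices labelled $i$ and vertices labelled $j$ (for $i\neq j$); renaming label $i$ to label $j$. *)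

(* Defs.v *)
From HB Require Import structures.
From mathcomp Require Import all_boot.
From mathcomp Require Import boolp.

Set Implicit Arguments.
Unset Strict Implicit.
Unset Printing Implicit Defensive.

Record graph := Graph {
  vertex :> finType;
  adj : rel vertex;
  adj_sym : symmetric adj;
  adj_irr : irreflexive adj;
  vertex_gt0 : 0 < #|vertex| }.

Arguments adj {g}.

Definition isomorphic (G H : graph) : Prop :=
  exists f : G -> H, bijective f /\ forall x y, adj (f x) (f y) = adj x y.

Section Induced.
Variables (G : graph) (H : {H : {set G} | H != set0}).

Definition induced_adj : rel {x : G | x \in val H} :=
  fun x y => adj (val x) (val y).

Lemma induced_sym : symmetric induced_adj.
Proof. by move=> x y; apply: adj_sym. Qed.

Lemma induced_irr : irreflexive induced_adj.
Proof. by move=> x; apply: adj_irr. Qed.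

Lemma induced_gt0 : 0 < #|{: {x : G | x \in val H}}|.
Proof.
case: H => A A_neq0 /=; rewrite card_sig.
by have /set0Pn[x xA] := A_neq0; apply/card_gt0P; exists x.
Qed.

Definition induced : graph := Graph induced_sym induced_irr induced_gt0.
End Induced.

Section Functionality.
Variable G : graph.

(* Repetitions among the x_i are allowed; this does not affect the minimal
   length below. *)
Definition is_function_of (y : G) (k : nat) (x : k.-tuple G) : bool :=
  (y \notin x) &&
  [exists f : {ffun k.-tuple bool -> bool}, forall z : G,
     (z != y) && (z \notin x) ==> (adj y z == f [tuple of map (adj^~ z) x])].

Lemma function_of_others (y : G) :
  [exists x : (size (enum (predC1 y))).-tuple G, is_function_of y x].
Proof.
apply/existsP; exists (in_tuple _).
rewrite /is_function_of mem_enum inE eqxx /=.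
apply/existsP; exists [ffun=> false]; apply/forallP=> z.
by rewrite mem_enum !inE; case: (z == y).
Qed.

Lemma is_function_of_exists (y : G) :
  exists k, [exists x : k.-tuple G, is_function_of y x].
Proof. by eexists; apply: function_of_others. Qed.

Definition vfun (y : G) : nat := ex_minn (is_function_of_exists y).

Lemma vfun_lt (y : G) : vfun y < #|G|.
Proof.
rewrite /vfun; case: ex_minnP => k _ /(_ _ (function_of_others y)) le_k.
by rewrite (leq_ltn_trans le_k) // -cardE cardC1 prednK // vertex_gt0.
Qed.

(* By vfun_lt and the nonemptiness of G, the default #|G| is never attained. *)
Definition min_vfun : nat := \big[minn/#|G|]_(y : G) vfun y.
End Functionality.

Definition functionality (G : graph) : nat :=
  \max_(H : {H : {set G} | H != set0}) min_vfun (induced H).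

Record lgraph (k : nat) := LGraph { lg :> graph; label : lg -> 'I_k }.

Arguments label {k l}.

Section LabelledOperations.
Variable k : nat.
Implicit Types (L : lgraph k) (i j : 'I_k).

Definition lnew_graph : graph.
Proof.
refine (@Graph unit (fun _ _ => false) _ _ _) => //.
by rewrite card_unit.
Defined.

Definition lnew i : lgraph k := @LGraph k lnew_graph (fun=> i).

Definition lunion_adj L1 L2 : rel (L1 + L2) := fun u v =>
  match u, v with
  | inl x, inl y => adj x y
  | inr x, inr y => adj x y
  | _, _ => false
  end.

Lemma lunion_sym L1 L2 : symmetric (@lunion_adj L1 L2).
Proof. by move=> [x|x] [y|y] //=; apply: adj_sym. Qed.

Lemma lunion_irr L1 L2 : irreflexive (@lunion_adj L1 L2).
Proof. by move=> [x|x] /=; apply: adj_irr. Qed.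

Lemma lunion_gt0 L1 L2 : 0 < #|{: L1 + L2}|.
Proof. by rewrite card_sum addn_gt0 vertex_gt0. Qed.

Definition lunion L1 L2 : lgraph k :=
  @LGraph k (Graph (@lunion_sym L1 L2) (@lunion_irr L1 L2) (lunion_gt0 L1 L2))
    (fun u => match u with inl x => label x | inr x => label x end).

Definition ljoin_adj i j L : rel L := fun x y =>
  [|| adj x y, (label x == i) && (label y == j)
    | (label x == j) && (label y == i)].

Lemma ljoin_sym i j L : symmetric (@ljoin_adj i j L).
Proof.
move=> x y; rewrite /ljoin_adj adj_sym; congr (_ || _).
by rewrite orbC andbC [X in _ || X]andbC.
Qed.

Lemma ljoin_irr i j L : i != j -> irreflexive (@ljoin_adj i j L).
Proof.
move=> neq_ij x; rewrite /ljoin_adj adj_irr /=.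
by case: (eqVneq (label x) i) => [->|_]; rewrite ?(negPf neq_ij) ?andbF.
Qed.

Definition ljoin i j (neq_ij : i != j) L : lgraph k :=
  @LGraph k (Graph (@ljoin_sym i j L) (@ljoin_irr i j L neq_ij) (vertex_gt0 L))
    (@label k L).

Definition lrename i j L : lgraph k :=
  @LGraph k L (fun x => if label x == i then j else label x).

Inductive cw_term : Type :=
| CwNew of 'I_k
| CwUnion of cw_term & cw_term
| CwJoin i j of i != j & cw_term
| CwRename of 'I_k & 'I_k & cw_term.

Fixpoint cw_value (t : cw_term) : lgraph k :=
  match t with
  | CwNew i => lnew i
  | CwUnion t1 t2 => lunion (cw_value t1) (cw_value t2)
  | CwJoin i j neq_ij t1 => ljoin neq_ij (cw_value t1)
  | CwRename i j t1 => lrename i j (cw_value t1)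
  end.
End LabelledOperations.

Definition constructible (G : graph) (k : nat) : Prop :=
  exists t : cw_term k, isomorphic (cw_value t) G.

Section CliqueWidthExists.
Variable G : graph.

Lemma cw_edgeless (v : G) (s : seq G) : uniq (v :: s) ->
  exists (t : cw_term #|G|) (p : cw_value t -> G),
    [/\ injective p, forall x, (x \in v :: s) <-> (exists u, p u = x),
        forall u, label u = enum_rank (p u) & forall u w : cw_value t, adj u w = false].
Proof.
elim: s v => [|v' s IHs] v.
  move=> _; exists (CwNew (enum_rank v)), (fun=> v); split=> //.
    by move=> [] [].
  by move=> x; rewrite inE; split=> [/eqP->|[_ ->]] //; exists tt.
rewrite cons_uniq => /andP[vNs /IHs[t [p [pI pS pL pA]]]].
exists (CwUnion (CwNew (enum_rank v)) t).
exists (fun u => match u with inl _ => v | inr w => p w end); split.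
- have Nv w : p w <> v.
    by move=> e; move/negP: vNs; apply; apply/pS; exists w.
  move=> [[]|w] [[]|w'] //=.
  + by move=> e; case: (Nv w').
  + by move=> e; case: (Nv w).
  + by move/pI=> ->.
- move=> x; rewrite inE; split.
    case/predU1P=> [->|/pS[u <-]]; first by exists (inl tt).
    by exists (inr u).
  case=> [[[]|w]] <-; first by rewrite eqxx.
  by apply/orP; right; apply/pS; exists w.
- by move=> [[]|w] /=.
- by move=> [[]|w] [[]|w'] /=.
Qed.

Lemma cw_edges (es : seq (G * G)) : (forall e, e \in es -> e.1 != e.2) ->
  exists (t : cw_term #|G|) (p : cw_value t -> G),
    [/\ bijective p, forall u, label u = enum_rank (p u)
      & forall u w, adj u w = ((p u, p w) \in es) || ((p w, p u) \in es)].
Proof.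
elim: es => [_|[a b] es IHes esN].
  have := enum_uniq G; have := mem_enum G.
  case: (enum G) => [|v s] sE.
    by have /card_gt0P[x _] := vertex_gt0 G; have := sE x.
  case/cw_edgeless=> t [p [pI pS pL pA]]; exists t, p; split=> //.
  have /fin_all_exists[q qK] : forall x, exists u, p u = x.
    by move=> x; apply/pS; rewrite sE.
  by exists q => // u; apply: pI.
have [|t [p [pB pL pA]]] := IHes.
  by move=> e e_es; apply: esN; rewrite inE e_es orbT.
have ab : enum_rank a != enum_rank b.
  by rewrite (inj_eq enum_rank_inj) (esN (a, b)) ?mem_head.
exists (CwJoin ab t), p; split=> // u w.
rewrite /= /ljoin_adj pA !pL !(inj_eq enum_rank_inj) !inE !xpair_eqE.
rewrite [(p u == b) && _]andbC.
by case: (_ && _); case: (_ && _); case: (_ \in _); case: (_ \in _).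
Qed.

Lemma constructible_exists : exists k, `[< constructible G k >].
Proof.
exists #|G|; apply/asboolP.
have [|t [p [pB _ pA]]] := @cw_edges (enum [pred e : G * G | adj e.1 e.2]).
  move=> [x y]; rewrite mem_enum inE /=.
  by apply: contraTneq => ->; rewrite adj_irr.
exists t, p; split=> // x y.
by rewrite pA !mem_enum !inE /= [adj (p y) _]adj_sym orbb.
Qed.
End CliqueWidthExists.

Definition cwd (G : graph) : nat := ex_minn (constructible_exists G).

Lemma cwd_gt0 (G : graph) : 0 < cwd G.
Proof.
rewrite /cwd; case: ex_minnP => [[|k]] // /asboolP[t _] _.
by elim: t => // [[]].
Qed.

(* Main.v *)
(** Let [H] be an induced subgraph of a graph built by a [k]-label term, and
    consider a lowest node of the term at which two vertices of [H] share a
    label. Each child of the node carries at most [k] vertices of [H], so the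
    node carries at most [2 * k] of them; and two vertices [x], [y] sharing a
    label there are not distinguished by the rest of [H]. Hence [x] is a
    function of the other vertices of the node, the value being read off [y].
    If there is no such node then [H] has at most [k] vertices. *)
Require Import Defs.
From HB Require Import structures.
From mathcomp Require Import all_boot.
From mathcomp Require Import boolp.

Set Implicit Arguments.
Unset Strict Implicit.
Unset Printing Implicit Defensive.

Lemma min_vfun_le (G : graph) (x : G) : min_vfun G <= vfun x.
Proof.
rewrite /min_vfun; elim: (index_enum G) (mem_index_enum x) => // y s IHs.
rewrite big_cons inE => /predU1P[<-|/IHs]; first exact: geq_minl.
by apply: leq_trans; apply: geq_minr.
Qed.

(** The other vertices of [S] serve as arguments. As [y] is one of them, the Boolean function can be
    the projection onto the coordinate of [y]. *)
Lemma vfun_twins (G : graph) (S : {set G}) (x y : G) :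
    x \in S -> y \in S -> x != y ->
    (forall z, z \notin S -> adj x z = adj y z) ->
  vfun x <= #|S|.-1.
Proof.
move=> xS yS neq_xy twin; rewrite /vfun; case: ex_minnP => n _; apply.
have -> : #|S|.-1 = size (enum (S :\ x)) by rewrite -cardE (cardsD1 x S) xS.
have yT : y \in enum (S :\ x) by rewrite mem_enum !inE eq_sym neq_xy.
apply/existsP; exists (in_tuple (enum (S :\ x))).
rewrite /is_function_of mem_enum !inE eqxx /=; apply/existsP.
exists [ffun b : (size (enum (S :\ x))).-tuple bool =>
  nth false b (index y (enum (S :\ x)))].
apply/forallP => z; apply/implyP; rewrite mem_enum !inE => /andP[-> zS] /=.
by rewrite ffunE /= (nth_map x) ?index_mem // nth_index // twin.
Qed.

Section LabelTwins.
Variable k : nat.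

Lemma card_label_inj (L : lgraph k) (A : {set L}) :
  {in A &, injective (@label k L)} -> #|A| <= k.
Proof.
by move=> /card_in_imset <-; rewrite -[leqRHS]card_ord max_card.
Qed.

(** Invariant carried up the term, with [A] the part of the induced subgraph built so far. The
    common label makes later operations treat [x] and [y] alike; [S] stays fixed while [A] grows. *)
Definition label_twins (L : lgraph k) (A : {set L}) : Prop :=
  exists S : {set L}, exists x y : L,
    [/\ [/\ S \subset A, x \in S & y \in S], x != y, #|S| <= 2 * k,
        label x = label y
      & forall z, z \in A :\: S -> adj x z = adj y z].

(** If a label repeats in [A], take [S = A]: no vertex is left to distinguish the pair. *)
Lemma label_twins_full (L : lgraph k) (A : {set L}) :
  #|A| <= 2 * k -> {in A &, injective (@label k L)} \/ label_twins A.
Proof.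
move=> leA; case: (boolP [exists u : L * L,
    [&& u.1 \in A, u.2 \in A, u.1 != u.2 & label u.1 == label u.2]]).
  case/existsP=> -[x y] /= /and4P[xA yA neq_xy /eqP eq_l].
  by right; exists A, x, y; split=> // z; rewrite setDv inE.
move/existsPn=> noT; left=> x y xA yA eq_l; apply/eqP.
by have := noT (x, y); rewrite /= xA yA eq_l eqxx andbT negbK.
Qed.

(** Vertices of the other summand are adjacent to neither twin, so the same [S] works. *)
Lemma label_twins_unionl (L1 L2 : lgraph k) (A : {set lunion L1 L2}) :
  label_twins [set u : L1 | inl u \in A] -> label_twins A.
Proof.
case=> S [x [y [[/subsetP sSA xS yS] neq_xy leS eq_l twin]]].
exists [set inl u | u in S], (inl x), (inl y); split=> //.
- split; try exact: imset_f.
  by apply/subsetP=> _ /imsetP[u uS ->]; have := sSA u uS; rewrite inE.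
- by rewrite card_imset // => u v [].
- move=> [z|z] //; rewrite inE mem_imset; last by move=> u v [].
  by move=> zAS; apply: twin; rewrite !inE.
Qed.

Lemma label_twins_unionr (L1 L2 : lgraph k) (A : {set lunion L1 L2}) :
  label_twins [set u : L2 | inr u \in A] -> label_twins A.
Proof.
case=> S [x [y [[/subsetP sSA xS yS] neq_xy leS eq_l twin]]].
exists [set inr u | u in S], (inr x), (inr y); split=> //.
- split; try exact: imset_f.
  by apply/subsetP=> _ /imsetP[u uS ->]; have := sSA u uS; rewrite inE.
- by rewrite card_imset // => u v [].
- move=> [z|z] //; rewrite inE mem_imset; last by move=> u v [].
  by move=> zAS; apply: twin; rewrite !inE.
Qed.

Lemma card_union_set (T1 T2 : finType) (A : {set T1 + T2}) :
  #|A| <= #|[set u | inl u \in A]| + #|[set u | inr u \in A]|.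
Proof.
rewrite -(card_imset _ (@inl_inj T1 T2)) -(card_imset _ (@inr_inj T1 T2)).
apply: leq_trans (leq_card_setU _ _); apply: subset_leq_card.
by apply/subsetP=> [[u|u] uA]; rewrite inE; apply/orP; [left|right];
  apply: imset_f; rewrite inE.
Qed.

Lemma cw_label_twins (t : cw_term k) (A : {set cw_value t}) :
  {in A &, injective (@label k (cw_value t))} \/ label_twins A.
Proof.
elim: t A => [i|t1 IH1 t2 IH2|i j neq_ij t IHt|i j t IHt] A.
- by left=> -[] [].
- have [inj1|/label_twins_unionl] := IH1 [set u | inl u \in A]; last by right.
  have [inj2|/label_twins_unionr] := IH2 [set u | inr u \in A]; last by right.
  (* Each side has distinct labels, hence at most [k] vertices: this is the source of [2 * k]. *)
  apply: label_twins_full; rewrite mul2n -addnn.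
  apply: leq_trans (card_union_set A) _.
  by apply: leq_add; apply: card_label_inj.
(* The edges added at a vertex depend only on its label, so twins stay twins. *)
- have [inj|[S [x [y [? ? ? eq_l twin]]]]] := IHt A; first by left.
  right; exists S, x, y; split=> // z /twin.
  by rewrite /= /ljoin_adj eq_l => ->.
(* Renaming may merge labels, but distinct labels before it bound [A] by [k]. *)
- have [inj|[S [x [y [? ? ? eq_l twin]]]]] := IHt A.
    apply: label_twins_full; apply: leq_trans (leq_pmull k (ltn0Sn 1)).
    exact: (@card_label_inj (cw_value t)).
  by right; exists S, x, y; split=> //=; rewrite eq_l.
Qed.

Lemma min_vfun_embedding (H : graph) (t : cw_term k) (p : H -> cw_value t) :
    injective p -> (forall x y, adj (p x) (p y) = adj x y) ->
  min_vfun H <= 2 * k - 1.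
Proof.
move=> p_inj p_adj; have [inj|] := cw_label_twins [set p u | u in H].
  have /card_gt0P[x _] := vertex_gt0 H.
  apply: leq_trans (min_vfun_le x) _; have := vfun_lt x.
  have := card_label_inj inj; rewrite card_imset //.
  (* Truncated subtraction requires [0 < 2 * k], which holds as [H] is nonempty with at most [k]
     vertices. *)
  move=> leHk lt_x; rewrite leq_subRL; last first.
    by rewrite muln_gt0 /= (leq_trans _ leHk) // vertex_gt0.
  by rewrite add1n (leq_trans lt_x) // (leq_trans leHk) // leq_pmull.
case=> S [u [v [[/subsetP sSp uS vS] neq_uv leS _ twin]]].
have /imsetP[x _ defu] := sSp _ uS; have /imsetP[y _ defv] := sSp _ vS.
subst u v.
apply: leq_trans (min_vfun_le x) _.
(* Pulled back along the injection [p], [S] does not grow and still contains both twins. *)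
apply: (@leq_trans #|p @^-1: S|.-1).
  apply: (@vfun_twins _ _ x y); rewrite ?inE //.
    by apply: contraNneq neq_uv => ->.
  by move=> z; rewrite inE -!p_adj => zS; apply: twin; rewrite inE zS imset_f.
rewrite -subn1 leq_sub2r // (leq_trans _ leS) // -(card_imset _ p_inj).
by apply: subset_leq_card; apply/subsetP=> _ /imsetP[u + ->]; rewrite inE.
Qed.

End LabelTwins.

Theorem theorem2 (G : graph) : functionality G <= 2 * cwd G - 1.
Proof.
rewrite /cwd; case: ex_minnP => k /asboolP[t [f [[g fK gK] f_adj]]] _.
apply/bigmax_leqP => H _; apply: (@min_vfun_embedding k (induced H) t (fun x => g (val x))).
  by move=> x y /(can_inj gK)/val_inj.
by move=> x y; rewrite -f_adj /= !gK.
Qed.
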